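(* Let $s,t\ge 1$ and $h\ge 3$ be fixed integers. Let $\mathcal{F}$ be a family of subsets of $[n]$ that contains no $h+s+t-2$ different sets $A_1,\dots,A_s,B_1,\dots,B_{h-2},C_1,\dots,C_t$ such that $A_1,A_2,\dots,A_s\subset B_1\subset B_2\subset\dots\subset B_{h-2}\subset C_1,C_2,\dots,C_t$ (each $A_i$ is contained in $B_1$, and $B_{h-2}$ is contained in each $C_j$), $|A_1|=|A_2|=\dots=|A_s|$ and $|C_1|=|C_2|=\dots=|C_t|$. Then $$|\mathcal{F}|\le \Sigma(n,h-1)+\binom{n}{\lfloor\frac{n+h}{2}\rfloor}\left(\frac{2(s+t-2)}{n}+O\left(\frac{\sqrt{\log n}}{n^{3/2}}\right)\right),$$ where the implied constant in the $O(\cdot)$ term does not depend on $n$.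
   Context: $[n]=\{1,2,\dots,n\}$. For integers $n,k$, $\Sigma(n,k)=\sum_{i=\lceil\frac{n-k}{2}\rceil}^{\lceil\frac{n+k}{2}\rceil-1}\binom{n}{i}$ denotes the sum of the $k$ largest binomial coefficients $\binom{n}{i}$. *)

(* Defs.v *)
From mathcomp Require Import all_boot.

Set Implicit Arguments.
Unset Strict Implicit.
Unset Printing Implicit Defensive.

(* uphalf m is the ceiling of m / 2.  When n < k the truncated difference
   n - k only drops negative indices, whose binomial coefficients are 0. *)
Definition Sigma (n k : nat) : nat :=
  (\sum_(uphalf (n - k) <= i < uphalf (n + k)) 'C(n, i))%N.

(* The ground set [n] is 'I_n.  For h >= 3 the tuple B is nonempty, so the
   default value set0 of head and last (the sets B_1 and B_(h-2)) is not used. *)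
Definition forbidden (n s h t : nat) (A : s.-tuple {set 'I_n})
    (B : (h - 2).-tuple {set 'I_n}) (C : t.-tuple {set 'I_n}) : bool :=
  [&& uniq (A ++ B ++ C),
      all (fun X : {set 'I_n} => X \subset head set0 B) A,
      sorted (fun X Y : {set 'I_n} => X \subset Y) B,
      all (fun X : {set 'I_n} => last set0 B \subset X) C,
      constant [seq #|X| | X : {set 'I_n} <- A]
    & constant [seq #|X| | X : {set 'I_n} <- C]].

Definition forbidden_free (n s h t : nat) (F : {set {set 'I_n}}) : Prop :=
  ~ exists (A : s.-tuple {set 'I_n}) (B : (h - 2).-tuple {set 'I_n})
      (C : t.-tuple {set 'I_n}),
      {subset A ++ B ++ C <= F} /\ forbidden A B C.

(* Main.v *)
(* Let lambda(F) be the Lubell function, the expected number of members of F on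
   a random full chain.  Keep only the members of F whose size lies between lo
   and n - lo, with lo about n/2 - 6 sqrt(n log n); by a Chernoff bound the
   others are negligible.  Call B in F thin if F has fewer than s sets of each
   size strictly below B, cothin if it has fewer than t sets of each size
   strictly above B.  The sets that are neither contain no chain of length
   h - 2, since such a chain would extend to a forbidden configuration, so they
   contribute at most h - 3 to lambda.  A random chain ending at a thin B meets
   on average at most (s - 1)(2/n + O(sqrt(log n) n^(-3/2))) further members of
   F, and conditioning on the largest thin set of the chain shows that the thin
   sets contribute at most 1 plus that quantity; dually for the cothin sets.
   Hence lambda(F) is at most h - 1 + 2(s + t - 2)/n + O(sqrt(log n) n^(-3/2)),
   and |F| is largest, for a given lambda(F), when F fills the largest levels. *)
Require Import Defs.
From mathcomp Require Import all_boot all_order all_algebra.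
From mathcomp Require Import zify ring lra.
Import Order.TTheory GRing.Theory Num.Theory.
Local Open Scope ring_scope.

(** * The Lubell function and its averaging recursion *)

Section Lubell.
Context {R : realFieldType} {T : finType}.
Implicit Types (F G : {set {set T}}) (A B X : {set T}).

(* The expected number of members of F on a uniformly random full chain
   from the empty set to X. *)
Definition lubell F X : R := \sum_(A in F | A \subset X) ('C(#|X|, #|A|)%:R)^-1.

Lemma lubellD1 F X : lubell F X = (X \in F)%:R + lubell (F :\ X) X.
Proof.
rewrite /lubell; case XF: (X \in F); last first.
  rewrite add0r; apply: eq_bigl => A; rewrite !inE.
  by case: eqP => [->|//]; rewrite XF.
rewrite (bigD1 X) /=; last by rewrite XF subxx.
rewrite binn invr1; congr (_ + _); apply: eq_bigl => A; rewrite !inE.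
by rewrite andbC andbA.
Qed.

Lemma lubell_le F G X : F \subset G -> lubell F X <= lubell G X.
Proof.
move=> FG; rewrite /lubell [leRHS](bigID (mem F)) /=.
rewrite [leLHS](_ : _ =
    \sum_(A | [&& A \in G, A \subset X & A \in F]) ('C(#|X|, #|A|)%:R)^-1).
  under [X in _ <= X + _]eq_bigl do rewrite -andbA.
  by rewrite lerDl sumr_ge0 // => A _; rewrite invr_ge0 ler0n.
apply: eq_bigl => A; case AF: (A \in F); last by rewrite !andbF.
by rewrite (subsetP FG _ AF) andbT.
Qed.

Lemma lubellU F G X : lubell (F :|: G) X <= lubell F X + lubell G X.
Proof.
rewrite /lubell [leLHS]big_mkcond [X in _ <= X + _]big_mkcond.
rewrite [X in _ <= _ + X]big_mkcond /=.
rewrite -big_split; apply: ler_sum => A _; rewrite inE.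
have := ler0n R 'C(#|X|, #|A|); rewrite -invr_ge0.
by case: (A \in F); case: (A \in G); case: (A \subset X) => /=; lra.
Qed.

(* Below X, a random full chain to X passes through X :\ x for a uniform x. *)
Lemma lubell_average F X (b : R) : 0 <= b ->
  (forall x, x \in X -> lubell F (X :\ x) <= b) -> lubell (F :\ X) X <= b.
Proof.
move=> b0 H; have [->|X0] := eqVneq X set0.
  rewrite /lubell big_pred0 // => A; rewrite !inE subset0.
  by case: eqP; rewrite ?andbF.
have X1 : 0 < (#|X|%:R : R) by rewrite ltr0n card_gt0.
rewrite -(ler_pM2r X1) [leRHS]mulr_natr -[leRHS]sumr_const.
apply: (le_trans _ (ler_sum _ H)); rewrite le_eqVlt; apply/orP; left; apply/eqP.
rewrite /lubell.
rewrite (exchange_big_dep (fun A => (A \in F :\ X) && (A \subset X))) /=; last first.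
  move=> x A xX /andP[AF AX]; rewrite !inE AF andbT.
  apply/andP; split; last by apply: (subset_trans AX); apply: subD1set.
  by apply/eqP => AE; move: AX; rewrite AE => /subsetP/(_ x xX); rewrite !inE eqxx.
rewrite mulr_suml; apply: eq_bigr => A /andP[AF AX].
rewrite (eq_bigl (mem (X :\: A))); last first.
  move=> x; rewrite !inE; case xX: (x \in X); rewrite ?andbF //= ?andbT.
  move: AF; rewrite !inE => /andP[_ ->] /=.
  by rewrite subsetD1 AX.
rewrite (eq_bigr (fun=> ('C(#|X|.-1, #|A|)%:R)^-1)); last first.
  by move=> x /setDP[xX _]; rewrite [in RHS](cardsD1 x X) xX.
rewrite sumr_const cardsDS // -[RHS]mulr_natr.
have AltX : (#|A| < #|X|)%N.
  by apply: proper_card; rewrite properEneq AX andbT; move: AF; rewrite !inE => /andP[].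
(* This gives [(|X| - |A|) / C(|X| - 1, |A|) = |X| / C(|X|, |A|)]; the factor [|X| - |A|] counts the
   points [x] whose removal leaves [A] inside [X :\ x]. *)
have := mul_bin_down #|X| #|A| => /(congr1 (fun n : nat => n%:R : R)).
rewrite !natrM => E.
have C1 : ('C(#|X|, #|A|)%:R : R) != 0 by rewrite pnatr_eq0 -lt0n bin_gt0 ltnW.
have C2 : ('C(#|X|.-1, #|A|)%:R : R) != 0 by rewrite pnatr_eq0 -lt0n bin_gt0; lia.
by rewrite mulrC [RHS]mulrC; apply/eqP; rewrite eqr_div // E.
Qed.

(** Descend from [X] by averaging until the chain first meets [F]: that set counts 1, and what lies
    below it at most [e] on average. *)
Lemma lubell_le_thin F (e : R) : 0 <= e ->
  (forall B, B \in F -> lubell (F :\ B) B <= e) -> forall X, lubell F X <= 1 + e.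
Proof.
move=> e0 H X; have [n] := ubnP #|X|; elim: n X => // n IH X ltn.
rewrite lubellD1; case XF: (X \in F); first by rewrite lerD2l H.
rewrite add0r; apply: lubell_average; first by rewrite addr_ge0.
by move=> x xX; apply: IH; move: ltn; rewrite (cardsD1 x X) xX; lia.
Qed.

(** If [X] is in [F], it can be put in front of any chain strictly below it and so uses up one unit
    of [k]; otherwise average over the sets [X :\ x]. *)
Lemma lubell_le_height F k X :
  (forall c : seq {set T}, sorted (fun A B => B \proper A) c ->
    all (fun A => (A \in F) && (A \subset X)) c -> (size c <= k)%N) ->
  lubell F X <= k%:R.
Proof.
have [n] := ubnP #|X|; elim: n X k => // n IH X k ltn H.
have lt x : x \in X -> (#|X :\ x| < n)%N.
  by move=> xX; move: ltn; rewrite (cardsD1 x X) xX; lia.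
rewrite lubellD1; case XF: (X \in F); last first.
  rewrite add0r; apply: lubell_average => // x xX.
  apply: IH; first exact: lt.
  move=> c sc /allP ac; apply: H => //; apply/allP => A /ac /andP[-> AX].
  by apply: (subset_trans AX); apply: subD1set.
case: k H => [|k] H.
  by have := H [:: X] isT; rewrite /= XF subxx => /(_ isT).
rewrite -natr1 addrC lerD2r; apply: lubell_average => // x xX.
apply: IH; first exact: lt.
move=> c sc /allP ac; apply: (H (X :: c)); last first.
  rewrite /= XF subxx; apply/allP => A /ac /andP[-> AX].
  by apply: (subset_trans AX); apply: subD1set.
rewrite /= path_sortedE; last by move=> ? ? ? h1 h2; apply: proper_trans h2 h1.
rewrite sc andbT; apply/allP => A /ac /andP[_ AX].
by apply: (sub_proper_trans AX); rewrite properD1.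
Qed.

(** Complementation reverses full chains; this carries bounds from thin to cothin sets. *)
Lemma lubell_setC F : lubell [set ~: A | A in F] [set: T] = lubell F [set: T].
Proof.
rewrite /lubell.
under eq_bigl do rewrite subsetT andbT.
under [RHS]eq_bigl do rewrite subsetT andbT.
rewrite big_imset /=; last by move=> A B _ _; apply: setC_inj.
apply: eq_bigr => A _; rewrite (_ : #|~: A| = #|T| - #|A|)%N.
  by rewrite cardsT bin_sub // max_card.
by rewrite cardsCs setCK.
Qed.

End Lubell.

(** * Sums of reciprocal binomial coefficients *)

Lemma bin_ge_square (lo i b : nat) :
  (lo <= i)%N -> (i.+1 < b)%N -> (lo ^ 2 <= 2 * 'C(b, i))%N.
Proof.
move=> li ib; apply: (@leq_trans (2 * 'C(i.+2, i))); last by rewrite leq_mul2l leq_bin2l.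
rewrite -bin_sub; last by lia.
have -> : (i.+2 - i = 2)%N by lia.
have := mul_bin_diag i.+2 1; rewrite bin1 /= => <-.
by rewrite expnS expn1 leq_mul //; lia.
Qed.

(** The term [i = b - 1] is [1 / b]. Each of the others, at most [hi - lo] in number, is at most
    [2 / lo ^ 2] because [C(b, i) >= C(i + 2, 2)]. *)
Lemma sum_inv_bin (R : realFieldType) (lo hi b : nat) :
  (0 < lo)%N -> (lo <= hi)%N -> (b <= hi)%N ->
  \sum_(lo <= i < b) ('C(b, i)%:R)^-1 <=
    lo%:R^-1 + 2 * (hi - lo)%:R / lo%:R ^+ 2 :> R.
Proof.
move=> lo0 lohi bhi.
have loR : 0 < (lo%:R : R) by rewrite ltr0n.
have [blo|lob] := leqP b lo.
  rewrite big_geq // addr_ge0 // ?invr_ge0 ?ler0n //.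
  by rewrite mulr_ge0 ?invr_ge0 ?exprn_ge0 ?mulr_ge0 ?ler0n.
case: b bhi lob => // b bhi lob; rewrite big_nat_recr //= binSn addrC.
apply: lerD; first by rewrite lef_pV2 ?posrE ?ltr0n // ler_nat ltnW.
apply: (@le_trans _ _ (\sum_(lo <= i < b) (2 / lo%:R ^+ 2))).
  rewrite big_nat [leRHS]big_nat; apply: ler_sum => i /andP[loi ib].
  have C0 : 0 < ('C(b.+1, i)%:R : R) by rewrite ltr0n bin_gt0; lia.
  rewrite ler_pdivlMr ?exprn_gt0 // ler_pdivrMl //.
  by rewrite -natrX mulrC -natrM ler_nat bin_ge_square.
rewrite sumr_const_nat -[leLHS]mulr_natr mulrAC ler_wpM2r ?invr_ge0 ?exprn_ge0 ?ler0n //.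
by rewrite ler_pM2l // ler_nat; lia.
Qed.

(** * Thin sets, cothin sets and the remaining ones *)

Section Thin.
Context {T : finType}.
Implicit Types (F : {set {set T}}) (A B X : {set T}).

Definition below F B i := [set A in F | (A \proper B) && (#|A| == i)].

Definition thin s F : {set {set T}} :=
  [set B in F | [forall i : 'I_#|T|.+1, #|below F B i| < s]%N].

(** Encoded by complementation instead of counting supersets, so that the results on [thin] can be
    reused. *)
Definition cothin s F : {set {set T}} :=
  [set ~: B | B in thin s [set ~: B | B in F]].

Lemma lubell_thin (R : realFieldType) F (s lo hi : nat) :
  (0 < s)%N -> (0 < lo)%N -> (lo <= hi)%N ->
  (forall A, A \in F -> lo <= #|A| <= hi)%N ->
  lubell (thin s F) [set: T] <=
    1 + (s - 1)%:R * (lo%:R^-1 + 2 * (hi - lo)%:R / lo%:R ^+ 2) :> R.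
Proof.
move=> s0 lo0 lohi sz.
apply: lubell_le_thin.
  rewrite mulr_ge0 ?ler0n // addr_ge0 ?invr_ge0 ?ler0n //.
  by rewrite mulr_ge0 ?invr_ge0 ?exprn_ge0 ?mulr_ge0 ?ler0n.
move=> B; rewrite inE => /andP[BF /forallP Bthin].
have thinF : thin s F \subset F by apply/subsetP => A; rewrite inE => /andP[].
apply: (le_trans (lubell_le _ _ _ (setSD [set B] thinF))).
have szB := sz _ BF; rewrite /lubell.
(* Sort the sets below [B] by size: since [B] is thin, each size occurs at most [s - 1] times. *)
rewrite (eq_bigr (fun A => \sum_(lo <= i < #|B| | i == #|A|) ('C(#|B|, i)%:R)^-1)); last first.
  move=> A /andP[]; rewrite !inE => /andP[AB AF] sAB.
  have : (#|A| < #|B|)%N by apply: proper_card; rewrite properEneq AB.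
  by rewrite big_nat1_eq; move: (sz _ AF) => /andP[-> _] ->.
rewrite (exchange_big_dep xpredT) //=.
have sinv := sum_inv_bin R lo hi #|B| lo0 lohi; move: szB => /andP[_ Bhi].
apply: (le_trans _ (ler_wpM2l (ler0n _ _) (sinv Bhi))); rewrite mulr_sumr.
apply: ler_sum_nat => i /andP[loi iB].
rewrite (eq_bigl (mem (below F B i))) /=; last first.
  move=> A; rewrite !inE properEneq [i == _]eq_sym.
  by case: (A \in F); case: (A == B); case: (A \subset B).
rewrite sumr_const -[leLHS]mulr_natl ler_wpM2r ?invr_ge0 ?ler0n // ler_nat.
have iT : (i < #|T|.+1)%N by rewrite ltnS (leq_trans (ltnW iB)) ?max_card.
by rewrite -ltnS subn1 prednK //; apply: (Bthin (Ordinal iT)).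
Qed.

Lemma lubell_cothin (R : realFieldType) F (s lo hi : nat) :
  (0 < s)%N -> (0 < lo)%N -> (lo <= hi)%N -> (hi + lo)%N = #|T| ->
  (forall A, A \in F -> lo <= #|A| <= hi)%N ->
  lubell (cothin s F) [set: T] <=
    1 + (s - 1)%:R * (lo%:R^-1 + 2 * (hi - lo)%:R / lo%:R ^+ 2) :> R.
Proof.
move=> s0 lo0 lohi hilo sz; rewrite lubell_setC; apply: lubell_thin => //.
by move=> _ /imsetP[A /sz + ->]; rewrite [#|~: A|]cardsCs setCK; lia.
Qed.

Lemma ex_uniq_tuple (S : {set {set T}}) s : (s <= #|S|)%N ->
  exists A : s.-tuple {set T}, uniq A /\ {subset A <= S}.
Proof.
move=> sS; have szA : size (take s (enum S)) == s.
  by rewrite size_takel // -cardE.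
exists (Tuple szA); split => [|X] /=; first by rewrite take_uniq // enum_uniq.
by move=> /mem_take; rewrite mem_enum.
Qed.

Lemma notin_thin s F B : B \in F -> B \notin thin s F ->
  exists (i : nat) (A : s.-tuple {set T}), uniq A /\ {subset A <= below F B i}.
Proof.
move=> BF; rewrite inE BF /= negb_forall => /existsP[i]; rewrite -leqNgt.
by move=> /ex_uniq_tuple[A HA]; exists i, A.
Qed.

Lemma notin_cothin s F B : B \in F -> B \notin cothin s F ->
  exists (i : nat) (C : s.-tuple {set T}), uniq C /\
    forall X, X \in C -> [/\ X \in F, B \proper X & #|X| = i].
Proof.
move=> BF BC; have [||i [A [uA sA]]] := notin_thin s [set ~: B | B in F] (~: B).
- by rewrite imset_f.
- by apply: contra BC => BC; apply/imsetP; exists (~: B); rewrite ?setCK.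
exists (#|T| - i)%N, [tuple of [seq ~: X | X : {set T} <- A]]; split.
  by rewrite map_inj_uniq //; apply: setC_inj.
move=> _ /mapP[X /sA + ->]; rewrite inE => /andP[/imsetP[Y YF ->] /andP[YB /eqP <-]].
by rewrite setCK YF -properC YB [#|~: Y|]cardsCs setCK subKn // max_card.
Qed.

Lemma sorted_proper_head (c : seq {set T}) X :
  sorted (fun A B => A \proper B) c -> X \in c -> head set0 c \subset X.
Proof.
case: c => //= b c pc; rewrite inE => /orP[/eqP-> //|Xc].
have tr : transitive (fun A B : {set T} => A \proper B).
  by move=> ? ? ?; apply: proper_trans.
by apply: proper_sub; move: (order_path_min tr pc) => /allP/(_ _ Xc).
Qed.

Lemma sorted_proper_last (c : seq {set T}) X :
  sorted (fun A B => A \proper B) c -> X \in c -> X \subset last set0 c.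
Proof.
case: c => //= b c; elim: c b X => [|a c IH] b X /=; first by rewrite inE => _ /eqP->.
move=> /andP[ba pc]; rewrite inE => /orP[/eqP->|]; last exact: IH.
by apply: (subset_trans (proper_sub ba)); apply: IH; rewrite ?inE ?eqxx.
Qed.

End Thin.

(** In a chain of [h - 2] such sets, the smallest is not thin and supplies the [A], the largest is
    not cothin and supplies the [C]. *)
Lemma thick_height (n s t h : nat) (F : {set {set 'I_n}}) (c : seq {set 'I_n}) :
  (3 <= h)%N -> forbidden_free s h t F ->
  sorted (fun A B : {set 'I_n} => B \proper A) c ->
  {subset c <= F :\: (thin s F :|: cothin t F)} -> (size c <= h - 3)%N.
Proof.
move=> hh free sc cthick; rewrite leqNgt; apply/negP => hc.
(* [c] descends while the tuple [B] must ascend, hence the reversal. *)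
have szB : size (rev (take (h - 2) c)) == (h - 2)%N.
  by rewrite size_rev size_takel //; lia.
pose B := Tuple szB.
have sB : sorted (fun A B : {set 'I_n} => A \proper B) B by rewrite rev_sorted take_sorted.
have Bthick X : X \in (B : seq _) ->
    [/\ X \in F, X \notin thin s F & X \notin cothin t F].
  rewrite mem_rev => /mem_take /cthick.
  by rewrite !inE negb_or => /andP[/andP[? ?] ?].
have [hB lB] : head set0 B \in (B : seq _) /\ last set0 B \in (B : seq _).
  have : (0 < size B)%N by rewrite size_tuple; lia.
  by case: (tval B) => //= b b'; rewrite inE eqxx mem_last.
have [[hF hs _] [lF _ lt]] := (Bthick _ hB, Bthick _ lB).
have [/= i [A [uA sA]]] := notin_thin s F _ hF hs.
have [/= j [C [uC sC]]] := notin_cothin t F _ lF lt.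
have {}sA X : X \in A -> [/\ X \in F, X \proper head set0 B & #|X| = i].
  by move=> /sA; rewrite inE => /andP[? /andP[? /eqP]].
have AB X Y : X \in A -> Y \in (B : seq _) -> X \proper Y.
  by move=> /sA[_ XB _] YB; apply: (proper_sub_trans XB); apply: sorted_proper_head.
have BC X Y : X \in (B : seq _) -> Y \in C -> X \proper Y.
  by move=> XB /sC[_ YB _]; apply: (sub_proper_trans _ YB); apply: sorted_proper_last.
apply: free; exists A, B, C; split.
  move=> X; rewrite !mem_cat => /or3P[/sA[]|/Bthick[]|/sC[]] //.
have uB : uniq B.
  apply: (sorted_uniq _ _ sB) => [? ? ?|?]; [exact: proper_trans|by rewrite properxx].
apply/and5P; split.
- rewrite !cat_uniq uA uB uC /= andbT; apply/andP; split.
    apply/hasPn => X; rewrite mem_cat => /orP[XB|XC]; apply/negP => XA.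
      by have := AB _ _ XA XB; rewrite properxx.
    have [] := sC _ XC; move=> _ lX _.
    by have := proper_trans (AB _ _ XA lB) lX; rewrite properxx.
  apply/hasPn => X XC; apply/negP => XB.
  by have := BC _ _ XB XC; rewrite properxx.
- by apply/allP => X /sA[_ /proper_sub].
- by apply: sub_sorted sB => X Y /proper_sub.
- by apply/allP => X /sC[_ /proper_sub].
- apply/andP; split; [apply: (@all_pred1_constant _ i)|apply: (@all_pred1_constant _ j)];
    rewrite all_map; apply/allP => X; first by move=> /sA[_ _ /= ->].
  by move=> /sC[_ _ /= ->].
Qed.

(** The main term [h - 1] is [(h - 3) + 1 + 1], from the remaining, the thin and the cothin sets. *)
Lemma lubell_forbidden_free (R : realFieldType) (n s t h lo : nat) (F : {set {set 'I_n}}) :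
  (1 <= s)%N -> (1 <= t)%N -> (3 <= h)%N ->
  (0 < lo)%N -> (lo.*2 <= n)%N ->
  (forall A, A \in F -> lo <= #|A| <= n - lo)%N ->
  forbidden_free s h t F ->
  lubell F [set: 'I_n] <= (h - 1)%:R +
    (s + t - 2)%:R * (lo%:R^-1 + 2 * (n - lo.*2)%:R / lo%:R ^+ 2) :> R.
Proof.
move=> s1 t1 h3 lo0 lon sz free.
have hilo : (n - lo - lo = n - lo.*2)%N by lia.
have lohi : (lo <= n - lo)%N by lia.
have L := lubell_thin R F s lo (n - lo) s1 lo0 lohi sz.
have U := lubell_cothin R F t lo (n - lo) t1 lo0 lohi.
rewrite card_ord subnK in U; last by lia.
move: (U erefl sz) L => {}U; rewrite hilo in U * => L.
have M : lubell (F :\: (thin s F :|: cothin t F)) [set: 'I_n] <= (h - 3)%:R :> R.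
  apply: lubell_le_height => c sc /allP ac; apply: (thick_height n s t h F) => //.
  by move=> X /ac/andP[].
apply: (@le_trans _ _ (lubell ((F :\: (thin s F :|: cothin t F)) :|:
    (thin s F :|: cothin t F)) [set: 'I_n])).
  by apply: lubell_le; apply/subsetP => X XF; rewrite !inE XF andbT orNb.
apply: (le_trans (lubellU _ _ _)).
have := lubellU (R := R) (thin s F) (cothin t F) [set: 'I_n].
have -> : (h - 1 = h - 3 + 2)%N by lia.
have -> : (s + t - 2 = (s - 1) + (t - 1))%N by lia.
by rewrite !natrD; move: U L M; set e := _ + _ / _; lra.
Qed.

(** * From the Lubell function to cardinality *)

Lemma bin_antimono (n i j : nat) : (n <= i.*2.+1)%N -> (i <= j)%N -> ('C(n, j) <= 'C(n, i))%N.
Proof.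
move=> ni /subnKC <-; elim: (j - i)%N => [|d IH]; first by rewrite addn0.
apply: leq_trans IH; rewrite addnS -(@leq_pmul2l (i + d).+1) //.
by rewrite mul_bin_left leq_mul2r; apply/orP; right; lia.
Qed.

(** Here [i] is at least as close to [n / 2] as [j]; if it lies left of the middle, reflect it to
    [n - i]. *)
Lemma bin_le_dist (n i j : nat) : (i <= n)%N -> (n <= j.*2.+1)%N ->
  (i <= j)%N -> (n <= i + j)%N -> ('C(n, j) <= 'C(n, i))%N.
Proof.
move=> in_ nj ij nij; have [ni|ni] := leqP n i.*2.+1; first exact: bin_antimono.
by rewrite -(bin_sub in_); apply: bin_antimono; lia.
Qed.

Lemma card_set_ord (n : nat) (A : {set 'I_n}) : (#|A| <= n)%N.
Proof. by have := max_card (mem A); rewrite card_ord. Qed.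

Lemma sum_by_card (R : realFieldType) (n : nat) (P : pred nat) (f : nat -> R) :
  \sum_(A : {set 'I_n} | P #|A|) f #|A| =
  \sum_(0 <= i < n.+1 | P i) 'C(n, i)%:R * f i.
Proof.
rewrite (eq_bigr (fun A : {set 'I_n} => \sum_(0 <= i < n.+1 | i == #|A|) f i)).
  rewrite (exchange_big_dep P) /=; last by move=> A i PA /eqP ->.
  apply: eq_bigr => i Pi; rewrite (eq_bigl (mem [set A : {set 'I_n} | #|A| == i])).
    by rewrite sumr_const card_draws card_ord mulr_natl.
  by move=> A; rewrite !inE eq_sym; case: eqP => [->|]; rewrite ?Pi ?andbF.
by move=> A _; rewrite big_nat1_eq ltnS card_set_ord.
Qed.

(* The weight of each of the k largest levels is at least M, that of every
   other level at most M. *)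
Lemma card_le_lubell (R : realFieldType) (n k : nat) (F : {set {set 'I_n}}) :
  (k <= n)%N ->
  #|F|%:R <= (Sigma n k)%:R +
    'C(n, uphalf (n + k))%:R * (lubell F [set: 'I_n] - k%:R) :> R.
Proof.
move=> kn; set M := 'C(n, uphalf (n + k)).
pose J := [pred i | uphalf (n - k) <= i < uphalf (n + k)]%N.
(* Writing 1 as [g i + M / C(n, i)] splits [|F|] into a sum of [g] and [M] times the Lubell
   function. The sign of [g] shows that its sum is largest over the full levels in [J]. *)
pose g i : R := 1 - M%:R / 'C(n, i)%:R.
have bin0 i : (i <= n)%N -> 0 < ('C(n, i)%:R : R) by rewrite ltr0n bin_gt0.
have gJ i : (i <= n)%N -> J i -> 0 <= g i.
  move=> in_ /andP[Ji1 Ji2]; rewrite subr_ge0 ler_pdivrMr ?bin0 // mul1r ler_nat.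
  by apply: bin_le_dist => //; rewrite !uphalf_half in Ji1 Ji2 *; lia.
have gJC i : (i <= n)%N -> ~~ J i -> g i <= 0.
  move=> in_; rewrite /J /= negb_and -ltnNge -leqNgt => Ji.
  rewrite subr_le0 ler_pdivlMr ?bin0 // mul1r ler_nat.
  have [Ji1|Ji1] := leqP (uphalf (n + k)) i.
    by apply: bin_antimono => //; rewrite uphalf_half; lia.
  rewrite -(bin_sub in_).
  by apply: bin_antimono => //; rewrite !uphalf_half in Ji Ji1 *; lia.
have sumJ : \sum_(A : {set 'I_n} | J #|A|) g #|A| = (Sigma n k)%:R - M%:R * k%:R.
  rewrite sum_by_card (eq_bigr (fun i => 'C(n, i)%:R - M%:R)); last first.
    move=> i /andP[Ji1 Ji2]; rewrite mulrBr mulr1 mulrCA divff ?mulr1 //.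
    by rewrite lt0r_neq0 // bin0 //; rewrite !uphalf_half in Ji2; lia.
  have -> : \sum_(0 <= i < n.+1 | J i) ('C(n, i)%:R - M%:R) =
      \sum_(uphalf (n - k) <= i < uphalf (n + k)) ('C(n, i)%:R - M%:R) :> R.
    rewrite [RHS](big_nat_widenl _ 0) // [RHS](big_nat_widen _ _ n.+1).
      by apply: eq_bigl => i; rewrite /J /= andbC.
    by rewrite uphalf_half; lia.
  rewrite big_split /= sumr_const_nat -natr_sum mulNrn; congr (_ - _).
  by rewrite -[LHS]mulr_natr; congr (_ * _%:R); rewrite !uphalf_half; lia.
have -> : #|F|%:R = \sum_(A in F) g #|A| + M%:R * lubell F [set: 'I_n] :> R.
  rewrite /lubell cardsT card_ord mulr_sumr.
  under [X in _ + X]eq_bigl do rewrite subsetT andbT.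
  rewrite -big_split /= -sumr_const; apply: eq_bigr => A _; rewrite /g.
  by rewrite subrK.
rewrite mulrBr addrA addrAC lerD2r -sumJ.
rewrite big_mkcond [leRHS]big_mkcond; apply: ler_sum => A _.
have An := card_set_ord n A.
have [JA|JA] := boolP (J #|A|); case: ifP => // _; last exact: gJC.
exact: gJ.
Qed.

Lemma card_outside (R : realFieldType) (n lo : nat) (b : R) (F : {set {set 'I_n}}) :
  (0 < lo)%N -> (lo.*2 <= n)%N -> (forall i, (i < lo)%N -> 'C(n, i)%:R <= b) ->
  (forall A, A \in F -> ~~ (lo <= #|A| <= n - lo)%N) ->
  #|F|%:R <= n.+1%:R * b.
Proof.
move=> lo0 lon Hb HF.
pose P := [pred i | ~~ (lo <= i <= n - lo)%N].
have -> : #|F|%:R = \sum_(A in F) 1 :> R by rewrite sumr_const.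
apply: (@le_trans _ _ (\sum_(A : {set 'I_n} | P #|A|) 1)).
  rewrite big_mkcond [leRHS]big_mkcond; apply: ler_sum => A _.
  case: ifP => [AF|_]; last by case: ifP.
  by rewrite (_ : P #|A| = true) //; apply: HF.
rewrite (sum_by_card _ _ P (fun=> 1)) big_mkord.
apply: (@le_trans _ _ (\sum_(i < n.+1) b)).
  rewrite big_mkcond /=; apply: ler_sum => i _; rewrite mulr1.
  have [Pi|Pi] := ifP; last by apply: (le_trans (ler0n _ _) (Hb 0%N lo0)).
  have [/Hb //|loi] := ltnP i lo.
  by rewrite -(bin_sub (ltn_ord i : i <= n)%N); apply: Hb; lia.
by rewrite sumr_const card_ord mulr_natl.
Qed.

Lemma forbidden_free_sub (n s t h : nat) (F G : {set {set 'I_n}}) :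
  F \subset G -> forbidden_free s h t G -> forbidden_free s h t F.
Proof.
move=> /subsetP FG free [A [B [C [sub forb]]]]; apply: free.
by exists A, B, C; split => // X /sub /FG.
Qed.

(** The Lubell bound handles the sizes from [lo] to [n - lo], and the last summand pays for the
    others. The cut [lo] and the tail bound [b] are chosen later. *)
Lemma card_forbidden_free (R : realFieldType) (n s t h lo : nat) (b : R)
    (F : {set {set 'I_n}}) :
  (1 <= s)%N -> (1 <= t)%N -> (3 <= h)%N -> (h <= n)%N ->
  (0 < lo)%N -> (lo.*2 <= n)%N -> (forall i, (i < lo)%N -> 'C(n, i)%:R <= b) ->
  forbidden_free s h t F ->
  #|F|%:R <= (Sigma n (h - 1))%:R + 'C(n, (n + h)./2)%:R *
    ((s + t - 2)%:R * (lo%:R^-1 + 2 * (n - lo.*2)%:R / lo%:R ^+ 2)) +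
    n.+1%:R * b.
Proof.
move=> s1 t1 h3 hn lo0 lon Hb free.
pose F0 := [set A in F | (lo <= #|A| <= n - lo)%N].
have F0F : F0 \subset F by apply/subsetP => A; rewrite inE => /andP[].
rewrite -(cardsID F0 F) natrD; apply: lerD; last first.
  by apply: (card_outside _ _ lo) => // A; rewrite !inE => /andP[+ AF]; rewrite AF.
rewrite (setIidPr F0F).
have kn : (h - 1 <= n)%N by lia.
apply: (le_trans (card_le_lubell R n (h - 1) F0 kn)).
have -> : (n + h)./2 = uphalf (n + (h - 1)) by rewrite uphalfE; congr _./2; lia.
rewrite lerD2l ler_wpM2l // lerBlDl; apply: lubell_forbidden_free => //.
  by move=> A; rewrite inE => /andP[].
exact: forbidden_free_sub F0F free.
Qed.

(** * Elementary bounds on binomial coefficients *)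

Lemma bin_le_half (n i : nat) : ('C(n, i) <= 'C(n, n./2))%N.
Proof.
have [ni|in_] := ltnP n i; first by rewrite bin_small.
have [hi|ih] := leqP n./2 i; first by apply: bin_antimono => //; lia.
by rewrite -bin_sub //; apply: bin_antimono; lia.
Qed.

(** In this range each step loses at most a factor 2: [C(n, m) <= 2 C(n, m + 1)] follows from
    [3 m + 1 <= 2 n]. *)
Lemma bin_half_addn (n d : nat) : (6 * d <= n)%N ->
  ('C(n, n./2) <= 2 ^ d * 'C(n, n./2 + d))%N.
Proof.
elim: d => [|d IH] dn; first by rewrite mul1n addn0.
apply: (leq_trans (IH _)); first by lia.
rewrite expnSr -mulnA leq_pmul2l ?expn_gt0 // -(@leq_pmul2l (n./2 + d).+1) //.
by rewrite mulnCA addnS mul_bin_left mulnA leq_mul2r; apply/orP; right; lia.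
Qed.

(** Converts a tail bound relative to [2 ^ n] into one relative to the binomial coefficient in front
    of the error term. *)
Lemma expn2_le_bin (n h : nat) : (6 * h <= n)%N ->
  (2 ^ n <= n.+1 * 2 ^ h * 'C(n, (n + h)./2))%N.
Proof.
move=> hn; have -> : (2 ^ n = \sum_(i < n.+1) 'C(n, i))%N.
  by rewrite -[2%N]/(1 + 1)%N expnDn; apply: eq_bigr => i _; rewrite !exp1n !muln1.
apply: (@leq_trans (\sum_(i < n.+1) 'C(n, n./2))).
  by apply: leq_sum => i _; apply: bin_le_half.
rewrite sum_nat_const card_ord -mulnA leq_pmul2l //.
have le_h : ((n + h)./2 - n./2 <= h)%N by lia.
apply: (leq_trans (bin_half_addn n ((n + h)./2 - n./2) _)); first by lia.
by rewrite subnKC ?leq_mul // ?leq_exp2l //; lia.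
Qed.

Lemma Sigma_full (n k : nat) : (n < k)%N -> Sigma n k = (2 ^ n)%N.
Proof.
move=> nk; rewrite /Sigma (_ : uphalf (n - k) = 0)%N; last by rewrite uphalf_half; lia.
rewrite (@big_cat_nat _ _ _ n.+1) //=; last by rewrite uphalf_half; lia.
rewrite [X in (_ + X)%N]big_nat_cond [X in (_ + X)%N]big1 => [|i]; last first.
  by rewrite andbT => /andP[ni _]; rewrite bin_small.
rewrite addn0 big_mkord -[2%N in RHS]/(1 + 1)%N expnDn.
by apply: eq_bigr => i _; rewrite !exp1n !muln1.
Qed.

Lemma card_family_ord (n : nat) (F : {set {set 'I_n}}) : (#|F| <= 2 ^ n)%N.
Proof.
rewrite -[n in (2 ^ n)%N]card_ord -cardsT -card_powerset subset_leq_card //.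
by apply/subsetP => A _; rewrite inE subsetT.
Qed.

(** The left side is one term in the expansion of [((1 + x) + (1 - x)) ^ n]. *)
Lemma bin_exp_bound (R : realFieldType) (n i : nat) (x : R) :
  0 <= x <= 1 -> (i <= n)%N ->
  'C(n, i)%:R * ((1 + x) ^+ (n - i) * (1 - x) ^+ i) <= 2 ^+ n.
Proof.
move=> /andP[x0 x1] in_; have -> : 2 = (1 + x) + (1 - x) :> R by lra.
rewrite [leRHS]exprDn mulr_natl; have i_n : (i < n.+1)%N by [].
rewrite (bigD1 (Ordinal i_n)) //= lerDl sumr_ge0 // => j _.
by rewrite mulrn_wge0 // mulr_ge0 // exprn_ge0 //; lra.
Qed.

From mathcomp Require Import all_classical all_reals all_analysis.
Import numFieldNormedType.Exports.

(** * Tail and error estimates over the reals *)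

Section Tail.
Context {R : realType}.
Implicit Types x y : R.

Lemma expR_half_le x : 0 <= x <= 1 -> expR (x / 2) <= 1 + x.
Proof.
move=> /andP[x0 x1]; have := expR_ge1Dx (- (x / 2)); rewrite expRN => h.
have e0 := expR_gt0 (x / 2).
have : (1 - x / 2) * expR (x / 2) <= 1 by rewrite -ler_pdivlMr // div1r.
by nra.
Qed.

Lemma expRN2_le x : 0 <= x <= 2^-1 -> expR (- (2 * x)) <= 1 - x.
Proof.
move=> /andP[x0 x1]; have := expR_ge1Dx (2 * x); rewrite expRN => h.
have e0 := expR_gt0 (2 * x).
by rewrite -div1r ler_pdivrMr //; nra.
Qed.

(* Markov's inequality with the tilt (1 + x, 1 - x) for x = sqrt (ln n / n). *)
Lemma bin_tail (n i : nat) x : (0 < n)%N -> 0 <= x <= 2^-1 ->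
  n%:R * x ^+ 2 = ln n%:R -> i%:R <= n%:R / 2 - 6 * n%:R * x ->
  'C(n, i)%:R <= 2 ^+ n / n%:R ^+ 4 :> R.
Proof.
move=> n0 /andP[x0 x1] nx ix.
have nR : 0 < (n%:R : R) by rewrite ltr0n.
have i0 : 0 <= (i%:R : R) by [].
have nx0 : 0 <= n%:R * x by rewrite mulr_ge0 // ltW.
have i2n : (i.*2 <= n)%N by rewrite -(ler_nat R) -muln2 natrM; lra.
have in_ : (i <= n)%N by lia.
rewrite ler_pdivlMr ?exprn_gt0 //.
have x01 : 0 <= x <= 1 by lra.
apply: le_trans (bin_exp_bound R n i x x01 in_); rewrite ler_wpM2l //.
(* Pair each factor [1 - x] with a factor [1 + x]; then [n - 2 i] factors [1 + x] remain. *)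
have -> : (n - i = (n - i.*2) + i)%N by lia.
rewrite exprD -mulrA -exprMn.
have -> : (1 + x) * (1 - x) = 1 - x ^+ 2 by ring.
have xx : 0 <= x ^+ 2 <= 2^-1 by rewrite sqr_ge0; nra.
have E1 : expR (x / 2) ^+ (n - i.*2) <= (1 + x) ^+ (n - i.*2).
  by apply: lerXn2r; rewrite ?nnegrE ?expR_ge0 ?expR_half_le //; lra.
have E2 : expR (- (2 * x ^+ 2)) ^+ i <= (1 - x ^+ 2) ^+ i.
  by apply: lerXn2r; rewrite ?nnegrE ?expR_ge0 ?expRN2_le //; lra.
apply: le_trans (ler_pM _ _ E1 E2); rewrite ?exprn_ge0 ?expR_ge0 //.
(* The exponents must satisfy [4 n x ^ 2 <= (n - 2 i) x / 2 - 2 i x ^ 2], which follows from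
   [n - 2 i >= 12 n x] and [2 i <= n]. *)
rewrite -{1}[n%:R]lnK ?posrE // -!expRM_natl -expRD ler_expR -nx.
rewrite natrB // -muln2 natrM.
have : 0 <= x * (n%:R / 2 - 6 * n%:R * x - i%:R) by rewrite mulr_ge0 //; lra.
have : 0 <= n%:R * x ^+ 2 by rewrite mulr_ge0 ?sqr_ge0 // ltW.
have : x ^+ 2 * i%:R <= x ^+ 2 * (n%:R / 2) by rewrite ler_wpM2l ?sqr_ge0 //; lra.
by lra.
Qed.

Lemma ln_le_2sqrt x : 0 < x -> ln x <= 2 * Num.sqrt x.
Proof.
move=> x0; have s0 : 0 < Num.sqrt x by rewrite sqrtr_gt0.
rewrite -{1}[x](sqr_sqrtr (ltW x0)) lnXn // -[leLHS]mulr_natl ler_pM2l //.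
exact: ltW (ln_sublinear s0).
Qed.

(** The first threshold gives [ln n >= 1], hence [n x >= 1]. The second gives
    [sqrt n >= 1600 >= 2 * 28 ^ 2], hence [x <= 1 / 28] by [ln n <= 2 sqrt n]. *)
Lemma scale_bounds (n : nat) :
  expR 1 <= n%:R :> R -> (40 ^+ 2) ^+ 2 <= n%:R :> R ->
  let x : R := Num.sqrt (ln n%:R / n%:R) in
  [/\ 0 <= x <= 28^-1, 1 <= n%:R * x & n%:R * x ^+ 2 = ln n%:R].
Proof.
move=> en n40 x.
have nR : 0 < (n%:R : R) by apply: lt_le_trans en; apply: expR_gt0.
have ln1 : 1 <= ln (n%:R : R) by rewrite -[leLHS](expRK 1) ler_ln // posrE expR_gt0.
have xE : n%:R * x ^+ 2 = ln n%:R.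
  rewrite /x sqr_sqrtr; last by rewrite divr_ge0 // (le_trans ler01).
  by rewrite mulrC divfK // gt_eqF.
have x0 : 0 <= x by apply: sqrtr_ge0.
have n1 : 1 <= n%:R :> R by apply: le_trans en; apply: le_trans (expR_ge1Dx 1); lra.
split=> //; last first.
  have nx0 : 0 <= n%:R * x by rewrite mulr_ge0.
  rewrite -(ler_pXn2r (n := 2)) ?nnegrE // expr1n exprMn expr2 -mulrA xE.
  by rewrite mulr_ege1.
rewrite x0 /=.
have := ln_le_2sqrt _ nR; set s := Num.sqrt n%:R => lns.
have s0 : 0 <= s by apply: sqrtr_ge0.
have sE : s ^+ 2 = n%:R by rewrite sqr_sqrtr // ltW.
have s40 : 40 ^+ 2 <= s by rewrite -(ler_pXn2r (n := 2)) ?nnegrE // sE.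
rewrite -(ler_pXn2r (n := 2)) ?nnegrE // -(ler_pM2l nR) xE.
apply: (le_trans lns); rewrite -sE.
by nra.
Qed.

(** As [x <= 1 / 28], [lo >= n / 4]. The first term is at most [(2 + 56 x) / n]; the second is at
    most [448 x / n] since [n - 2 lo <= 14 n x]; and [504 = 56 + 448]. *)
Lemma error_bound (n lo : nat) x : 0 <= x <= 28^-1 -> (0 < n)%N ->
  n%:R / 2 - 7 * n%:R * x <= lo%:R -> (lo.*2 <= n)%N ->
  lo%:R^-1 + 2 * (n - lo.*2)%:R / lo%:R ^+ 2 <= 2 / n%:R + 504 * (x / n%:R).
Proof.
move=> /andP[x0 x1] n0 lox lon.
have nR : 0 < (n%:R : R) by rewrite ltr0n.
have nR' := ltW nR.
have lo4 : n%:R / 4 <= lo%:R :> R by nra.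
have lo0 : 0 < (lo%:R : R) by lra.
have E1 : lo%:R^-1 <= (2 + 56 * x) / n%:R.
  rewrite ler_pdivlMr // mulrC ler_pdivrMr //.
  apply: (@le_trans _ _ ((2 + 56 * x) * (n%:R / 2 - 7 * n%:R * x))).
    have : 0 <= n%:R * x * (1 - 28 * x) by rewrite !mulr_ge0 //; lra.
    by lra.
  by rewrite ler_wpM2l //; lra.
have E2 : 2 * (n - lo.*2)%:R / lo%:R ^+ 2 <= 448 * x / n%:R.
  rewrite ler_pdivrMr ?exprn_gt0 //.
  apply: (@le_trans _ _ (448 * x / n%:R * (n%:R / 4) ^+ 2)); last first.
    rewrite ler_wpM2l ?divr_ge0 ?mulr_ge0 //.
    by rewrite lerXn2r ?nnegrE ?divr_ge0.
  have -> : 448 * x / n%:R * (n%:R / 4) ^+ 2 = 28 * (n%:R * x).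
    by field; rewrite gt_eqF.
  by rewrite natrB // -muln2 natrM; lra.
by apply: (le_trans (lerD E1 E2)); rewrite le_eqVlt; apply/orP; left; apply/eqP; field;
  rewrite gt_eqF.
Qed.

Lemma sqrt_ln_div (n : nat) : (0 < n)%N ->
  Num.sqrt (ln (n%:R : R)) / n%:R `^ (3 / 2) = Num.sqrt (ln n%:R / n%:R) / n%:R.
Proof.
move=> n0; have nR : 0 < (n%:R : R) by rewrite ltr0n.
have -> : 3 / 2 = 1 + 2^-1 :> R by lra.
rewrite powRD; last by rewrite gt_eqF // implybT.
rewrite powRr1 ?ltW // powR12_sqrt ?ltW // sqrtrM ?ln_ge0 ?ler1n //.
by rewrite sqrtrV ?ltW // invfM [n%:R^-1 * _]mulrC mulrA.
Qed.

Lemma card_forbidden_free_large (n s t h : nat) (F : {set {set 'I_n}}) :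
  (1 <= s)%N -> (1 <= t)%N -> (3 <= h)%N -> (6 * h <= n)%N ->
  expR 1 <= n%:R :> R -> (40 ^+ 2) ^+ 2 <= n%:R :> R ->
  forbidden_free s h t F ->
  #|F|%:R <= (Sigma n (h - 1))%:R + 'C(n, (n + h)./2)%:R *
    (2 * (s + t - 2)%:R / n%:R +
     ((s + t - 2)%:R * 504 + 2 ^+ (h + 2)) *
       (Num.sqrt (ln (n%:R : R)) / n%:R `^ (3 / 2))).
Proof.
move=> s1 t1 h3 hn en n40 free.
have n0 : (0 < n)%N by lia.
have nR : 0 < (n%:R : R) by rewrite ltr0n.
rewrite sqrt_ln_div //; have [] := scale_bounds n en n40.
set x := Num.sqrt _ => x01 nx1 nx2; have /andP[x0 x28] := x01.
have y0 : 0 <= n%:R / 2 - 6 * n%:R * x by nra.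
have /andP[lo_le lo_gt] := truncn_itv y0.
set lo := Num.truncn _ in lo_le lo_gt.
(* Rounding down loses less than 1, which is at most [n x], so 6 becomes 7. *)
have lo_ge : n%:R / 2 - 7 * n%:R * x <= lo%:R by move: lo_gt; rewrite -natr1; lra.
have lo2 : (lo.*2 <= n)%N by rewrite -(ler_nat R) -muln2 natrM; lra.
have lo0 : (0 < lo)%N by rewrite -(ltr0n R); apply: lt_le_trans lo_ge; nra.
have tail i : (i < lo)%N -> 'C(n, i)%:R <= 2 ^+ n / n%:R ^+ 4 :> R.
  move=> ilo; apply: (bin_tail n i x) => //; first by lra.
  by apply: le_trans lo_le; rewrite ler_nat ltnW.
have hn' : (h <= n)%N by lia.
apply: (le_trans (card_forbidden_free R n s t h lo _ F s1 t1 h3 hn' lo0 lo2 tail free)).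
rewrite -addrA lerD2l.
set M : R := 'C(n, (n + h)./2)%:R; set e := (s + t - 2)%:R.
have M0 : 0 <= M by [].
have T1 : M * (e * (lo%:R^-1 + 2 * (n - lo.*2)%:R / lo%:R ^+ 2)) <=
    M * (e * (2 / n%:R + 504 * (x / n%:R))).
  by rewrite !ler_wpM2l ?error_bound.
(* Using [n + 1 <= 2 n] twice, the left side is at most [4 * 2 ^ h * M / n ^ 2]; then
   [1 / n <= x]. *)
have T2 : n.+1%:R * (2 ^+ n / n%:R ^+ 4) <= M * (2 ^+ (h + 2) * (x / n%:R)).
  have two_n : 2 ^+ n <= n.+1%:R * 2 ^+ h * M.
    by rewrite -!natrX -!natrM ler_nat expn2_le_bin.
  have nS : n.+1%:R <= 2 * n%:R :> R.
    have : 1 <= n%:R :> R by rewrite ler1n.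
    by rewrite -natr1; lra.
  apply: (@le_trans _ _ (2 * n%:R * (2 * n%:R * 2 ^+ h * M / n%:R ^+ 4))).
    apply: ler_pM => //; rewrite ?divr_ge0 ?exprn_ge0 //.
    rewrite ler_wpM2r ?invr_ge0 ?exprn_ge0 //; apply: (le_trans two_n).
    by rewrite !ler_wpM2r ?exprn_ge0.
  have -> : 2 * n%:R * (2 * n%:R * 2 ^+ h * M / n%:R ^+ 4) =
      M * (2 ^+ (h + 2) * (n%:R^-1 / n%:R)).
    by rewrite exprD; field; rewrite gt_eqF.
  rewrite !ler_wpM2l ?exprn_ge0 // ler_wpM2r ?invr_ge0 //.
  by rewrite -div1r ler_pdivrMr // mulrC.
apply: (le_trans (lerD T1 T2)).
by rewrite le_eqVlt; apply/orP; left; apply/eqP; ring.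
Qed.

End Tail.

Local Open Scope classical_set_scope.
Local Open Scope ring_scope.

Theorem theorem2p14 (R : realType) (s t h : nat)
    (hs : (1 <= s)%N) (ht : (1 <= t)%N) (hh : (3 <= h)%N) :
  exists err : nat -> R,
    (err =O_\oo (fun n : nat => Num.sqrt (ln (n%:R : R)) / n%:R `^ (3 / 2))) /\
    forall (n : nat) (F : {set {set 'I_n}}), (1 <= n)%N ->
      forbidden_free s h t F ->
      (#|F|%:R : R) <= (Sigma n (h - 1))%:R
        + 'C(n, (n + h)./2)%:R * (2 * (s + t - 2)%:R / n%:R + err n).
Proof.
pose g n : R := Num.sqrt (ln (n%:R : R)) / n%:R `^ (3 / 2).
pose K : R := (s + t - 2)%:R * 504 + 2 ^+ (h + 2).
(* The summands are nonnegative, so an [n] above their sum meets all three thresholds of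
   [card_forbidden_free_large]. *)
pose N := (Num.truncn ((40 ^+ 2) ^+ 2 + expR 1 + (6 * h)%:R : R)).+1.
have K0 : 0 < K by rewrite ltr_wpDl ?mulr_ge0 ?exprn_gt0.
(* The finitely many values below [N] do not affect the O-term; there [2 ^ n] makes the bound
   trivial. *)
exists (fun n => if (n < N)%N then 2 ^+ n else K * g n); split.
  apply/eqO_exP; exists K => //; near=> n.
  have -> : (n < N)%N = false by apply/negbTE; rewrite -leqNgt; near: n; exact: nbhs_infty_ge.
  by rewrite normrM gtr0_norm.
move=> n F n1 free; case: ifPn => [_|]; last first.
  rewrite -leqNgt => Nn.
  have e0 : 0 < expR 1 :> R := expR_gt0 1.
  have Nn' : (40 ^+ 2) ^+ 2 + expR 1 + (6 * h)%:R <= n%:R :> R.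
    apply: (@le_trans _ _ (N%:R : R)); last by rewrite ler_nat.
    by apply: ltW; apply: truncnS_gt.
  have h0 : 0 <= (6 * h)%:R :> R by [].
  apply: card_forbidden_free_large => //; last 2 first.
  - by lra.
  - by nra.
  - by rewrite -(ler_nat R); nra.
have F2 := card_family_ord n F.
(* If [n < h - 1], then [Sigma] is already [2 ^ n]. Otherwise [(n + h) / 2 <= n], so the binomial
   coefficient is at least 1 and the error term suffices. *)
have [nh|hn] := ltnP n (h - 1).
  rewrite Sigma_full //; apply: ler_wpDr; last by rewrite ler_nat.
  by rewrite mulr_ge0 // addr_ge0 ?divr_ge0 ?mulr_ge0 ?exprn_ge0.
apply: ler_wpDl => //; apply: (@le_trans _ _ (1 * 2 ^+ n)).
  by rewrite mul1r -natrX ler_nat.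
apply: ler_pM; rewrite ?exprn_ge0 //; first by rewrite ler1n bin_gt0; lia.
by rewrite lerDr divr_ge0 ?mulr_ge0.
Unshelve. all: by end_near.
Qed.
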